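(* There is a universal constant $c>0$ such that the following holds. Let $\Omega\subset\mathbb R^d$ be compact, $\mu$ a probability measure on $\Omega$, $q\in(2,\infty)$, $B>0$, and let $X_N$ be an $N$-dimensional subspace of $\mathcal C(\Omega)$ satisfying, for all integers $k\ge0$, $$ e_k(X_N^q,L_\infty)\le B\begin{cases}(N/2^k)^{1/q}, & k\le\log N,\\ 2^{-2^k/N}, & k\ge\log N.\end{cases} $$ Then for every integer $$ m\ge cq^2B^qN^{1-2/q}\max\Big\{\Big(\frac{N^{1/2}-N^{1/q}}{1/2-1/q}\Big)^2,\,N\Big\} $$ there are $m$ points $\xi^1,\dots,\xi^m\in\Omega$ such that $$ \frac12\|f\|_q^q\le\frac1m\sum_{j=1}^m|f(\xi^j)|^q\le\frac32\|f\|_q^q\qquad\forall f\in X_N. $$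
   Context: $\|f\|_q=(\int_\Omega|f|^qd\mu)^{1/q}$; $L_\infty$ denotes $\mathcal C(\Omega)$ with the norm $\|f\|_\infty=\max_\Omega|f|$. $X_N^q:=\{f\in X_N:\|f\|_q\le1\}$. For a set $A$ in a metric space with metric $d$, let $N_0=1$ and $N_n=2^{2^n}$ for $n\ge1$, and $e_n(A,d):=\inf\{\varepsilon:\exists f_1,\dots,f_{N_n}\in A,\ A\subset\bigcup_{j=1}^{N_n}\{g:d(f_j,g)<\varepsilon\}\}$; here $e_k(X_N^q,L_\infty)$ uses $d(f,g)=\|f-g\|_\infty$. *)

(* Defs.v *)
From HB Require Import structures.
From mathcomp Require Import all_boot all_order all_algebra.
From mathcomp Require Import all_classical all_reals all_analysis.
Set Implicit Arguments. Unset Strict Implicit. Unset Printing Implicit Defensive.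
Import Order.TTheory GRing.Theory Num.Theory.
Import numFieldNormedType.Exports.
Local Open Scope classical_set_scope.
Local Open Scope ring_scope.

Notation Rvec R d := 'rV[R]_d.

Definition Borel_Rd (R : realType) (d : nat) :=
  g_sigma_algebraType (@open (Rvec R d)).

Definition Lq_norm (R : realType) (d : nat)
  (mu : {measure set (Borel_Rd R d) -> \bar R}) (Omega : set (Rvec R d))
  (q : R) (f : Rvec R d -> R) : R :=
  (fine (\int[mu]_(x in (Omega : set (Borel_Rd R d))) ((`|f x| `^ q)%:E))) `^ q^-1.

Definition sup_norm (R : realType) (d : nat) (Omega : set (Rvec R d))
  (f : Rvec R d -> R) : R :=
  sup [set `|f x| | x in Omega].

Definition span_fun (R : realType) (d N : nat) (phi : 'I_N -> Rvec R d -> R)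
  : set (Rvec R d -> R) :=
  [set f | exists c : 'I_N -> R, f = (fun x => \sum_(i < N) c i * phi i x)].

Definition Lq_ball (R : realType) (d N : nat)
  (mu : {measure set (Borel_Rd R d) -> \bar R}) (Omega : set (Rvec R d))
  (q : R) (phi : 'I_N -> Rvec R d -> R) : set (Rvec R d -> R) :=
  [set f | span_fun phi f /\ Lq_norm mu Omega q f <= 1].

Definition Nent (n : nat) : nat := if n is 0 then 1%N else (2 ^ (2 ^ n))%N.

(* entropy number e_n(A, d), with values in the extended reals
   (infimum of the empty set is +oo) *)
Definition entropy_number {T : Type} (R : realType) (A : set T)
  (dist : T -> T -> R) (n : nat) : \bar R :=
  ereal_inf [set e%:E | e in
    [set e : R | exists F : 'I_(Nent n) -> T,
        (forall j, A (F j)) /\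
        (forall g, A g -> exists j, dist (F j) g < e)]].

Definition log2 (R : realType) (x : R) : R := ln x / ln 2.

(* Main.v *)
Require Import Defs.
From HB Require Import structures.
From mathcomp Require Import all_boot all_order all_algebra.
From mathcomp Require Import all_classical all_reals all_analysis.
From mathcomp Require Import measurable_realfun ring lra.
Import Order.TTheory GRing.Theory Num.Theory.
Import numFieldNormedType.Exports.
Local Open Scope classical_set_scope.
Local Open Scope ring_scope.

(** This is Dudley's chaining bound for the empirical process of the functions
    [|f|^q], [f] in the unit ball.  Comparing a centre of the one-element net
    with [f] and [-f] shows [|f| <= D = B N^(1/q)] on the ball, and then
    [(|f|^q - |g|^q)^2 <= q^2 D^(q-2) |f - g|^2 (|f|^q + |g|^q)],
    so that the Rademacher increments are controlled by the sup-distance times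
    the square root of the empirical [q]-norms.  Chaining through the nets given
    by the entropy numbers yields, for the expected deviation [W],
    [E W <= C A (1 + E W) / sqrt m], with
    [A = q D^((q-2)/2) \sum_k 2^(k/2) e_k], whose square is the bound on [m].

    All expectations are finite sums: [mu] is first replaced by a finitely
    supported measure that integrates accurately the finitely many functions of
    the finest net, and points are sampled from the latter. *)

Set Implicit Arguments.
Unset Strict Implicit.

(** * Exponential moments and maxima of Rademacher sums *)

Section Rademacher.
Variable R : realType.
Implicit Types (x s l : R) (m : nat).

(* The constant 2 is not sharp (1/2 is); it lets [1 / (1 - x^2)] do the work. *)
Lemma cosh_le_expR_sqr x : (expR x + expR (- x)) / 2 <= expR (2 * x ^+ 2).
Proof.
wlog x0 : x / 0 <= x.
  move=> H; case: (lerP 0 x) => [/H//|x0].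
  have := H (- x); rewrite opprK sqrrN addrC; apply; lra.
case: (lerP (1 / 2) x) => [x1|x1].
  have h1 : expR x <= expR (2 * x ^+ 2) by rewrite ler_expR; nra.
  have h2 : expR (- x) <= expR (2 * x ^+ 2) by rewrite ler_expR; nra.
  lra.
have h1 : expR x <= (1 - x)^-1.
  rewrite -[leLHS]invrK lef_pV2 ?posrE ?invr_gt0 ?expR_gt0//; last lra.
  by rewrite -expRN; exact: expR_ge1Dx.
have h2 : expR (- x) <= (1 + x)^-1.
  rewrite expRN lef_pV2 ?posrE ?expR_gt0//; last lra.
  exact: expR_ge1Dx.
apply: (le_trans _ (expR_ge1Dx _)).
have -> : 1 + 2 * x ^+ 2 = ((1 - x)^-1 + (1 + x)^-1) / 2
   + (x ^+ 2 - 2 * x ^+ 4) * ((1 - x)^-1 * (1 + x)^-1).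
  by field; apply/andP; split; lra.
have : 0 <= (x ^+ 2 - 2 * x ^+ 4) * ((1 - x)^-1 * (1 + x)^-1).
  apply: mulr_ge0; last by apply: mulr_ge0; rewrite invr_ge0; lra.
  have -> : x ^+ 2 - 2 * x ^+ 4 = x ^+ 2 * (1 - 2 * x ^+ 2) by ring.
  apply: mulr_ge0; nra.
lra.
Qed.

(** The sum over [e] weighted by [2 ^- m] is an expectation over independent signs, so the
    exponential factors over the coordinates, and each factor is a hyperbolic cosine. *)
Lemma rademacher_mgf m (a : 'I_m -> R) :
  \sum_(e : {ffun 'I_m -> bool}) 2 ^- m * expR (\sum_j (-1) ^+ e j * a j)
    <= expR (2 * \sum_j a j ^+ 2).
Proof.
under eq_bigr do rewrite expR_sum.
rewrite -mulr_sumr -(bigA_distr_bigA (fun j (b : bool) => expR ((-1) ^+ b * a j))).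
have -> : (2 : R) ^- m = \prod_(j < m) 2^-1.
  by rewrite prodr_const card_ord exprVn.
rewrite -big_split /= mulr_sumr expR_sum; apply: ler_prod => j _.
rewrite big_bool /= expr0 expr1 mul1r mulN1r; apply/andP; split.
  by rewrite mulr_ge0 ?invr_ge0// addr_ge0 ?expR_ge0.
by rewrite mulrC addrC; exact: cosh_le_expR_sqr.
Qed.

Lemma sum_signs m x : \sum_(e : {ffun 'I_m -> bool}) 2 ^- m * x = x.
Proof.
rewrite sumr_const card_ffun card_bool card_ord.
by rewrite -[LHS]mulr_natl natrX mulrA divff ?mul1r// expf_neq0// pnatr_eq0.
Qed.

(* The maximum over [J] is encoded by an arbitrary selection [u] of an index
   for each choice of signs. *)
Lemma rademacher_max m (J : finType) (Q : pred J) (X : J -> 'I_m -> R) (n : nat)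
    s l (u : {ffun 'I_m -> bool} -> J) :
  0 < l -> (#|J| <= n)%N -> (0 < n)%N ->
  (forall j, Q j -> \sum_i X j i ^+ 2 <= s ^+ 2) -> (forall e, Q (u e)) ->
  \sum_(e : {ffun 'I_m -> bool}) 2 ^- m * `|\sum_i (-1) ^+ e i * X (u e) i|
    <= (ln (2 * n%:R) + 2 * l ^+ 2 * s ^+ 2) / l.
Proof.
move=> l0 Jn n0 Qs Qu.
have n0' : 0 < n%:R :> R by rewrite ltr0n.
set L := ln (2 * n%:R) + _.
have expL : expR L = 2 * n%:R * expR (2 * l ^+ 2 * s ^+ 2).
  by rewrite expRD lnK// posrE; apply: mulr_gt0.
rewrite ler_pdivlMr// mulrC mulr_sumr.
pose S (e : {ffun 'I_m -> bool}) j : R := \sum_i (-1) ^+ e i * (l * X j i).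
(* The inequality [y <= L - 1 + expR (y - L)] is linear in [expR y], so it can be averaged without
   Jensen's inequality. [L] is chosen so that the averaged exponential term is at most 1. *)
apply: (@le_trans _ _ (\sum_(e : {ffun 'I_m -> bool})
   2 ^- m * (L - 1 + expR (- L) * \sum_(j | Q j) (expR (S e j) + expR (- S e j))))).
  apply: ler_sum => e _; rewrite mulrCA ler_wpM2l ?invr_ge0 ?exprn_ge0//.
  have -> : l * `|\sum_i (-1) ^+ e i * X (u e) i| = `|S e (u e)|.
    rewrite -[in LHS](gtr0_norm l0) -normrM mulr_sumr; congr (`| _ |).
    by apply: eq_bigr => i _; ring.
  have h1 : 1 + (`|S e (u e)| - L) <= expR (`|S e (u e)| - L) by exact: expR_ge1Dx.
  suff h2 : expR (`|S e (u e)| - L)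
     <= expR (- L) * \sum_(j | Q j) (expR (S e j) + expR (- S e j)) by lra.
  rewrite addrC expRD ler_wpM2l ?expR_ge0// (bigD1 (u e)) //=.
  rewrite -[leLHS]addr0; apply: lerD.
    by case: ger0P => _; rewrite ?lerDl ?lerDr expR_ge0.
  by apply: sumr_ge0 => j _; rewrite addr_ge0 ?expR_ge0.
under eq_bigr do rewrite mulrDr.
rewrite big_split /= sum_signs.
under eq_bigr do rewrite mulrCA.
rewrite -mulr_sumr.
have : \sum_(e : {ffun 'I_m -> bool}) 2 ^- m * \sum_(j | Q j) (expR (S e j) + expR (- S e j)) <= expR L.
  under eq_bigr do rewrite mulr_sumr.
  rewrite exchange_big /=.
  apply: (@le_trans _ _ (\sum_(j | Q j) 2 * expR (2 * l ^+ 2 * s ^+ 2))).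
    apply: ler_sum => j Qj.
    under eq_bigr do rewrite mulrDr.
    have sq (b : R) : b ^+ 2 = 1 -> \sum_i (b * (l * X j i)) ^+ 2 <= l ^+ 2 * s ^+ 2.
      move=> b1; under eq_bigr do rewrite exprMn b1 mul1r exprMn.
      by rewrite -mulr_sumr ler_wpM2l ?sqr_ge0// Qs.
    rewrite big_split /= [leRHS]mulr_natl [leRHS]mulr2n; apply: lerD.
      apply: (le_trans (rademacher_mgf (fun i => l * X j i))).
      rewrite ler_expR -mulrA ler_wpM2l//.
      by have := @sq 1; rewrite expr1n => /(_ erefl); under eq_bigr do rewrite mul1r.
    rewrite [leLHS](_ : _ = \sum_(e : {ffun 'I_m -> bool})
      2 ^- m * expR (\sum_i (-1) ^+ e i * (-1 * (l * X j i)))).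
      apply: (le_trans (rademacher_mgf (fun i => -1 * (l * X j i)))).
      rewrite ler_expR -mulrA ler_wpM2l//.
      by apply: sq; rewrite sqrrN expr1n.
    apply: eq_bigr => e _; congr (_ * expR _); rewrite /S -sumrN.
    by apply: eq_bigr => i _; ring.
  rewrite sumr_const -[leLHS]mulr_natl expL mulrCA -[leRHS]mulrA ler_wpM2l//.
  by rewrite ler_wpM2r ?expR_ge0// ler_nat (leq_trans _ Jn)// max_card.
move=> /(ler_wpM2l (expR_ge0 (- L))); rewrite expRN mulVf ?gt_eqF ?expR_gt0//.
lra.
Qed.

End Rademacher.

(** * Chaining along finite nets *)

Section Chaining.
Variable R : realType.
Implicit Types (K m : nat) (tau : R).

Lemma Nent_mul_le K : (Nent K.+1 * Nent K <= 2 ^ (3 * 2 ^ K))%N.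
Proof.
have : (Nent K.+1 * Nent K <= 2 ^ (2 ^ K.+1) * 2 ^ (2 ^ K))%N.
  by apply: leq_mul => //; case: K.
by rewrite -expnD expnS -mulSnr.
Qed.

(** Telescoping from the zero level: each link is selected among at most [Nent k.+1 * Nent k] pairs,
    so its expected maximum costs a multiple of [Num.sqrt 2 ^+ k * a k * tau]. Letting [sel] depend
    on the signs encodes the supremum over [T]. *)
Lemma chaining m K (T : Type) (g : forall k, 'I_(Nent k) -> 'I_m -> R)
    (p : forall k, T -> 'I_(Nent k)) (a : nat -> R) tau
    (sel : {ffun 'I_m -> bool} -> T) :
  (forall u i, g 0 u i = 0) -> (forall k, 0 < a k) -> 0 < tau ->
  (forall k t, (k < K)%N ->
     \sum_i (g k.+1 (p k.+1 t) i - g k (p k t) i) ^+ 2 <= (a k * tau) ^+ 2) ->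
  \sum_(e : {ffun 'I_m -> bool}) 2 ^- m * `|\sum_i (-1) ^+ e i * g K (p K (sel e)) i|
    <= 6 * tau * \sum_(k < K) Num.sqrt 2 ^+ k * a k.
Proof.
move=> g0 a0 tau0; elim: K => [|K IH] ga.
  rewrite big_ord0 mulr0 big1// => e _; rewrite big1 ?normr0 ?mulr0// => i _.
  by rewrite g0 mulr0.
rewrite big_ord_recr /= mulrDr.
have {}IH := IH (fun k t kK => ga k t (ltnW kK)).
pose J := ('I_(Nent K.+1) * 'I_(Nent K))%type.
pose X (uv : J) i : R := g K.+1 uv.1 i - g K uv.2 i.
pose s : R := a K * tau.
pose r : R := Num.sqrt 2 ^+ K.
have s0 : 0 < s by apply: mulr_gt0.
have r0 : 0 < r by rewrite exprn_gt0// sqrtr_gt0.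
have r2 : r ^+ 2 = 2 ^+ K by rewrite /r -exprM mulnC exprM sqr_sqrtr.
have ln2 : ln 2 <= 1 :> R by have := @le_ln1Dx R 1; rewrite [1 + 1]/2; apply; lra.
(* The predicate keeps only the short links, since arbitrary pairs of centres need not be close. The
   parameter [r / s] balances the log-cardinality, of order [r ^+ 2 = 2 ^+ K], against the variance
   term. *)
have := @rademacher_max R m J (fun uv => \sum_i X uv i ^+ 2 <= s ^+ 2) X
  (2 ^ (3 * 2 ^ K)) s (r / s) (fun e => (p K.+1 (sel e), p K (sel e))).
rewrite card_prod !card_ord => /(_ (divr_gt0 r0 s0) (Nent_mul_le K)).
rewrite expn_gt0 /= => /(_ isT (fun _ => id) (fun e => ga K (sel e) (ltnSn K))) => H.
have step : \sum_(e : {ffun 'I_m -> bool})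
    2 ^- m * `|\sum_i (-1) ^+ e i * X (p K.+1 (sel e), p K (sel e)) i|
    <= 6 * tau * (r * a K).
  apply: (le_trans H); rewrite natrX -exprS lnXn// ler_pdivrMr ?divr_gt0//.
  have -> : 6 * tau * (r * a K) * (r / s) = 6 * r ^+ 2.
    by rewrite /s; field; rewrite !gt_eqF.
  have -> : 2 * (r / s) ^+ 2 * s ^+ 2 = 2 * r ^+ 2 by field; rewrite gt_eqF.
  have K1 : 1 <= 2 ^+ K :> R by rewrite exprn_ege1// ler1n.
  suff : ln 2 *+ (3 * 2 ^ K).+1 <= 4 * 2 ^+ K :> R by rewrite r2; lra.
  rewrite -[leLHS]mulr_natl -addn1 natrD natrM natrX.
  apply: (@le_trans _ _ ((3 * 2 ^+ K + 1) * 1)); last by lra.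
  by apply: ler_wpM2l => //; lra.
apply: (le_trans _ (lerD IH step)); rewrite -big_split /=.
apply: ler_sum => e _; rewrite -mulrDr ler_wpM2l ?invr_ge0 ?exprn_ge0//.
apply: (le_trans _ (ler_normD _ _)); rewrite le_eqVlt; apply/orP; left; apply/eqP.
congr (`| _ |); rewrite -big_split /=; apply: eq_bigr => i _; rewrite /X /=; ring.
Qed.

End Chaining.

(** * Independent samples from a finite law and symmetrization *)

Section Symmetrization.
Variables (R : realType) (I : finType) (w : I -> R) (m : nat).
Hypotheses (w_ge0 : forall i, 0 <= w i) (w_sum1 : \sum_i w i = 1).

Definition iid (x : {ffun 'I_m -> I}) : R := \prod_j w (x j).

Lemma iid_ge0 x : 0 <= iid x.
Proof. by apply: prodr_ge0. Qed.

Lemma iid_sum1 : \sum_x iid x = 1.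
Proof.
rewrite -(bigA_distr_bigA (fun=> w)) /=.
by rewrite big1.
Qed.

(** The factor [f (x j)] is absorbed into the [j]-th factor of the product weight; distributivity
    then turns the sum of products into a product of sums. *)
Lemma iid_sum_coord (f : I -> R) j : \sum_x iid x * f (x j) = \sum_i w i * f i.
Proof.
pose F k i := w i * (if k == j then f i else 1).
rewrite (eq_bigr (fun x : {ffun 'I_m -> I} => \prod_k F k (x k))); last first.
  move=> x _; rewrite big_split /=; congr (_ * _).
  by rewrite -big_mkcond /= big_pred1_eq.
rewrite -(bigA_distr_bigA F) (bigD1 j)//= [X in _ * X]big1 ?mulr1.
  by apply: eq_bigr => i _; rewrite /F eqxx.
by move=> k kj; rewrite /F (negbTE kj); under eq_bigr do rewrite mulr1.
Qed.

Let sample := {ffun 'I_m -> I}.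

Definition swap (e : {ffun 'I_m -> bool}) (xy : sample * sample) : sample * sample :=
  ([ffun j => if e j then xy.2 j else xy.1 j],
   [ffun j => if e j then xy.1 j else xy.2 j]).

Lemma swapK e : involutive (swap e).
Proof.
by case=> x y; congr pair; apply/ffunP => j; rewrite !ffunE /=; case: (e j).
Qed.

(** A second, independent sample replaces the means, and exchanging coordinates between the two
    samples creates the random signs. The exchange also makes the selection depend on the signs,
    hence the hypothesis for every [sel']. *)
Lemma symmetrization (T : Type) (h : T -> I -> R) (b : sample -> R) (sel : sample -> T) :
  (forall (x : sample) (sel' : {ffun 'I_m -> bool} -> T),
     \sum_(e : {ffun 'I_m -> bool}) 2 ^- m * `|\sum_j (-1) ^+ e j * h (sel' e) (x j)| <= b x) ->
  \sum_x iid x * `|\sum_j (h (sel x) (x j) - \sum_i w i * h (sel x) i)|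
    <= 2 * \sum_x iid x * b x.
Proof.
move=> hb.
pose D t (xy : sample * sample) : R := \sum_j (h t (xy.1 j) - h t (xy.2 j)).
pose W (xy : sample * sample) := iid xy.1 * iid xy.2.
(* The selection depends on the first sample only, so averaging over the second one recovers the
   means; the triangle inequality takes the absolute value inside. *)
apply: (@le_trans _ _ (\sum_xy W xy * `|D (sel xy.1) xy|)).
  rewrite -(pair_bigA _ (fun x y => W (x, y) * `|D (sel x) (x, y)|)) /=.
  apply: ler_sum => x _; rewrite /W /=.
  under [leRHS]eq_bigr do rewrite -mulrA.
  rewrite -mulr_sumr ler_wpM2l ?iid_ge0//.
  under [leRHS]eq_bigr => y _ do rewrite -[iid y]ger0_norm ?iid_ge0// -normrM.
  apply: (le_trans _ (ler_norm_sum _ _ _)).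
  rewrite le_eqVlt; apply/orP; left; apply/eqP; congr (`| _ |).
  rewrite /D /=; under [RHS]eq_bigr do rewrite mulr_sumr.
  rewrite exchange_big /=; apply: eq_bigr => j _.
  under [RHS]eq_bigr do rewrite mulrBr.
  by rewrite sumrB -mulr_suml iid_sum1 mul1r iid_sum_coord.
(* The weight of a pair is invariant under [swap e], while the [j]-th difference changes sign
   exactly when [e j] holds. *)
have swp (e : {ffun 'I_m -> bool}) : \sum_xy W xy * `|D (sel xy.1) xy| =
    \sum_xy W xy * `|\sum_j (-1) ^+ e j * (h (sel (swap e xy).1) (xy.1 j)
                                         - h (sel (swap e xy).1) (xy.2 j))|.
  rewrite (reindex_inj (inv_inj (swapK e))) /=; apply: eq_bigr => -[x y] _.
  apply: (f_equal2 (fun u v => u * `|v|)).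
    rewrite /W /iid -!big_split /=; apply: eq_bigr => j _; rewrite !ffunE.
    by case: (e j) => //=; rewrite mulrC.
  apply: eq_bigr => j _; rewrite !ffunE /=; case: (e j) => /=.
    by rewrite expr1 mulN1r opprB.
  by rewrite expr0 mul1r.
rewrite -[leLHS](sum_signs m).
under eq_bigr => e _ do rewrite (swp e) mulr_sumr.
rewrite exchange_big /=.
apply: (@le_trans _ _ (\sum_xy W xy * (b xy.1 + b xy.2))).
  apply: ler_sum => -[x y] _.
  under eq_bigr do rewrite mulrCA.
  rewrite -mulr_sumr ler_wpM2l ?mulr_ge0 ?iid_ge0//.
  apply: (le_trans _ (lerD (hb x (fun e => sel (swap e (x, y)).1))
                           (hb y (fun e => sel (swap e (x, y)).1)))).
  rewrite -big_split /=; apply: ler_sum => e _.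
  rewrite -mulrDr ler_wpM2l ?invr_ge0 ?exprn_ge0//.
  under eq_bigr do rewrite mulrBr.
  by rewrite sumrB; exact: ler_normB.
rewrite -(pair_bigA _ (fun x y => W (x, y) * (b x + b y))) /= /W /=.
rewrite (eq_bigr (fun x => iid x * b x + iid x * \sum_y iid y * b y)); last first.
  move=> x _; under eq_bigr do rewrite mulrDr.
  rewrite big_split /=; congr (_ + _).
    by under eq_bigr do rewrite mulrAC; rewrite -mulr_sumr iid_sum1 mulr1.
  by rewrite mulr_sumr; apply: eq_bigr => y _; rewrite mulrA.
by rewrite big_split /= -mulr_suml iid_sum1 mul1r [leRHS]mulr_natl mulr2n.
Qed.

End Symmetrization.

(** * Good samples from a finitely supported measure *)

Section FiniteSampling.
Variable R : realType.

Lemma exists_le_mean (S : finType) (p f : S -> R) (c : R) :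
  (forall x, 0 <= p x) -> \sum_x p x = 1 -> \sum_x p x * f x <= c ->
  exists x, f x <= c.
Proof.
move=> p0 p1 pf; apply: contrapT => /forallNP fc.
have {}fc x : c < f x by rewrite ltNge; apply/negP/fc.
have : 0 < \sum_x p x * (f x - c).
  rewrite lt0r sumr_ge0 ?andbT; last first.
    by move=> x _; rewrite mulr_ge0// subr_ge0 ltW.
  apply/negP => /eqP h.
  suff : \sum_x p x = 0 by move/eqP; rewrite p1 oner_eq0.
  apply: big1 => x _; move: h => /eqP; rewrite psumr_eq0; last first.
    by move=> y _; rewrite mulr_ge0// subr_ge0 ltW.
  move=> /allP /(_ x); rewrite mem_index_enum => /(_ isT) /=.
  by rewrite mulf_eq0 subr_eq0 (gt_eqF (fc x)) orbF => /eqP.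
under eq_bigr do rewrite mulrBr.
by rewrite sumrB -mulr_suml p1 mul1r subr_gt0 ltNge pf.
Qed.

(** Increments are controlled by empirical sums, and these by the maximal deviation itself. Chaining
    therefore bounds the expected deviation by an affine function of itself of slope at most 1/20,
    and some sample does no worse than the average. *)
Lemma finite_sampling (I T : finType) (t0 : T) (w : I -> R) (m K : nat)
    (g : forall k, 'I_(Nent k) -> I -> R) (p : forall k, T -> 'I_(Nent k))
    (a : nat -> R) :
  (forall i, 0 <= w i) -> \sum_i w i = 1 -> (0 < m)%N ->
  (forall u i, g 0 u i = 0) -> (forall k, 0 < a k) ->
  (forall k t, (k <= K)%N -> exists t', forall i, g k (p k t) i <= g K (p K t') i + 1) ->
  (forall t, \sum_i w i * g K (p K t) i <= 2) ->
  (forall k t i, (k < K)%N ->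
     (g k.+1 (p k.+1 t) i - g k (p k t) i) ^+ 2
       <= a k ^+ 2 * (g k.+1 (p k.+1 t) i + g k (p k t) i)) ->
  240 * \sum_(k < K) Num.sqrt 2 ^+ k * a k <= Num.sqrt m%:R ->
  exists x : {ffun 'I_m -> I}, forall t,
    `|m%:R^-1 * \sum_j g K (p K t) (x j) - \sum_i w i * g K (p K t) i| <= 1 / 4.
Proof.
move=> w0 w1 m0 g0 a0 dom mean lip Am.
have mR : 0 < m%:R :> R by rewrite ltr0n.
set A := \sum_(k < K) _ in Am.
have A0 : 0 <= A.
  by apply: sumr_ge0 => k _; rewrite mulr_ge0 ?exprn_ge0 ?sqrtr_ge0// ltW.
set M := Num.sqrt m%:R in Am.
have M0 : 0 < M by rewrite sqrtr_gt0.
have M2 : M ^+ 2 = m%:R by rewrite sqr_sqrtr// ltW.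
pose h t i := g K (p K t) i.
pose dev (x : {ffun 'I_m -> I}) t := `|\sum_j (h t (x j) - \sum_i w i * h t i)|.
pose sel (x : {ffun 'I_m -> I}) := [arg max_(t > t0) dev x t]%O.
have selP x t : dev x t <= dev x (sel x).
  by rewrite /sel; case: arg_maxP => // t' _; apply.
have sumh (x : {ffun 'I_m -> I}) t : \sum_j h t (x j) <= m%:R * 2 + dev x (sel x).
  have := le_trans (ler_norm _) (selP x t).
  rewrite sumrB sumr_const card_ord -[X in _ - X]mulr_natl => h1.
  by have := ler_wpM2l (ltW mR) (mean t); rewrite /h in h1 *; lra.
(* With [W] the maximal deviation, empirical sums at every level are at most [m (3 + W / m)]: 2 from
   the mean, 1 from the comparison with the finest level. Two such bounds add up to at most
   [tau x ^+ 2]. *)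
pose tau x := M * (4 + dev x (sel x) / m%:R).
have dev0 x : 0 <= dev x (sel x) / m%:R.
  by rewrite divr_ge0 ?normr_ge0// ltW.
have chain (x : {ffun 'I_m -> I}) (sel' : {ffun 'I_m -> bool} -> T) :
    \sum_(e : {ffun 'I_m -> bool}) 2 ^- m * `|\sum_j (-1) ^+ e j * h (sel' e) (x j)|
      <= 6 * tau x * A.
  apply: (@chaining R m K T (fun k u j => g k u (x j)) p) => //.
    by rewrite /tau mulr_gt0//; have := dev0 x; lra.
  move=> k t kK; apply: (le_trans (ler_sum _ (fun j _ => lip k t (x j) kK))).
  rewrite -mulr_sumr exprMn ler_wpM2l ?sqr_ge0// big_split /=.
  have bnd k' : (k' <= K)%N ->
      \sum_j g k' (p k' t) (x j) <= m%:R * (3 + dev x (sel x) / m%:R).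
    move=> /(dom _ t)[t' ht']; apply: (le_trans (ler_sum _ (fun j _ => ht' (x j)))).
    rewrite big_split /= sumr_const card_ord -[1 *+ m]/(m%:R).
    have -> : m%:R * (3 + dev x (sel x) / m%:R) = m%:R * 3 + dev x (sel x).
      by field; rewrite gt_eqF.
    by have := sumh x t'; rewrite /h; lra.
  apply: (le_trans (lerD (bnd _ kK) (bnd _ (ltnW kK)))).
  rewrite /tau exprMn M2 -mulrDr ler_wpM2l ?(ltW mR)//.
  by have := dev0 x; nra.
pose EW := \sum_x iid w x * dev x (sel x).
have EWle : EW <= m%:R / 4.
  have : EW <= 2 * \sum_x iid w x * (6 * tau x * A) :=
    @symmetrization R I w m w0 w1 T h _ sel chain.
  have -> : \sum_x iid w x * (6 * tau x * A) = 6 * A * M * (4 + EW / m%:R).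
    transitivity (\sum_x 6 * A * M * (4 * iid w x + iid w x * dev x (sel x) / m%:R)).
      by apply: eq_bigr => x _; rewrite /tau; ring.
    by rewrite -mulr_sumr big_split /= -mulr_sumr -mulr_suml (iid_sum1 _ w1) mulr1.
  have EW0 : 0 <= EW.
    by apply: sumr_ge0 => x _; rewrite mulr_ge0 ?iid_ge0 ?normr_ge0.
  have hA : 240 * (A * M) <= m%:R by rewrite -M2 expr2 mulrA ler_wpM2r// ltW.
  have h4 : 0 <= 4 + EW / m%:R by rewrite addr_ge0// divr_ge0// ltW.
  have h5 : m%:R * (4 + EW / m%:R) = 4 * m%:R + EW by field; rewrite gt_eqF.
  have := ler_wpM2r h4 hA; rewrite h5.
  (* With [n = m], [u = EW] and [z = A M (4 + EW / m)], this yields [EW <= 4 m / 19], below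
     [m / 4]. *)
  have aux (u z n : R) : 0 < n -> 240 * z <= 4 * n + u -> u <= 2 * (6 * z) -> u <= n / 4.
    by lra.
  rewrite -[6 * A * M]mulrA -[6 * _ * (4 + _)]mulrA -[240 * _ * (4 + _)]mulrA.
  exact: aux.
have [x hx] := exists_le_mean (iid_ge0 w0) (iid_sum1 m w1) EWle.
exists x => t; have := le_trans (selP x t) hx.
rewrite /dev sumrB sumr_const card_ord -[X in _ - X]mulr_natl => hd.
rewrite -[\sum_i w i * g K (p K t) i](mulKf (lt0r_neq0 mR)) -mulrBr normrM.
rewrite gtr0_norm ?invr_gt0// ler_pdivrMl//.
by move: hd; rewrite /h; lra.
Qed.

End FiniteSampling.

(** * Replacing the measure by a finitely supported one *)

Section Discretization.

(** The values of all [h t] are rounded down to multiples of [e]. Points with the same rounded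
    values form finitely many cells, and one point per cell carries the measure of the cell. *)
Lemma finite_quadrature d (X : measurableType d) (R : realType)
    (mu : probability X R) (Om : set X) (T : finType) (h : T -> X -> R) (M e : R) :
  measurable Om -> mu Om = 1%E -> (forall t, measurable_fun Om (h t)) ->
  (forall t x, Om x -> 0 <= h t x <= M) -> 0 < e ->
  exists (I : finType) (w : I -> R) (pt : I -> X),
    [/\ forall i, Om (pt i), forall i, 0 <= w i, \sum_i w i = 1 &
      forall t, `|fine (\int[mu]_(x in Om) (h t x)%:E) - \sum_i w i * h t (pt i)| <= e].
Proof.
move=> mOm muOm mh hM e0.
have muOm1 : (mu : {measure set X -> \bar R}) Om = 1%E by [].
have [x0 Omx0] : exists x, Om x.
  apply: contrapT => /forallNP Om0; have : Om = set0 by apply/seteqP; split=> x // /Om0.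
  by move=> Oe; move: muOm; rewrite Oe measure0 => /esym/eqP; rewrite onee_eq0.
pose L := Num.truncn (M / e).
pose code x : {ffun T -> 'I_L.+1} := [ffun t => inord (Num.truncn (h t x / e))].
have codeE t x : Om x -> code x t = Num.truncn (h t x / e) :> nat.
  move=> Omx; rewrite ffunE inordK// ltnS; apply: le_truncn.
  by rewrite ler_pM2r ?invr_gt0//; have /andP[] := hM t x Omx.
(* Preimages of intervals make measurability visible; the outer [Om] matters when [T] is empty. *)
pose cell (c : {ffun T -> 'I_L.+1}) :=
  Om `&` \bigcap_(t in [set: T]) (Om `&` h t @^-1` `[(c t)%:R * e, (c t).+1%:R * e[).
have cellP c x : Om x -> cell c x <-> code x = c.
  move=> Omx.
  have he t k : Num.truncn (h t x / e) == k = (k%:R * e <= h t x < k.+1%:R * e).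
    have /andP[h0 _] := hM t x Omx.
    rewrite truncn_eq; last by rewrite divr_ge0// ltW.
    by rewrite ler_pdivlMr// ltr_pdivrMr.
  split=> [[_ cx]|<-].
    apply/ffunP => t; apply/val_inj => /=; rewrite codeE//; apply/eqP.
    by have [_ /=] := cx t I; rewrite in_itv /= -he.
  by split=> // t _; split=> //=; rewrite in_itv /= -he codeE.
have mcell c : measurable (cell c).
  apply: measurableI => //; apply: fin_bigcap_measurable => // t _.
  exact: mh.
pose w c := fine (mu (cell c)).
have wE c : mu (cell c) = (w c)%:E by rewrite fineK ?fin_num_measure.
have w0 c : 0 <= w c by rewrite fine_ge0.
have code_sum (v : {ffun T -> 'I_L.+1} -> R) x : Om x ->
    v (code x) = \sum_c v c * \1_(cell c) x.
  move=> Omx; rewrite (bigD1 (code x)) //= big1 ?addr0.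
    by rewrite indicE mem_set ?mulr1//; exact/cellP.
  move=> c /eqP cx; rewrite indicE memNset ?mulr0//.
  by move/cellP => /(_ Omx)/esym.
have mind (v : {ffun T -> 'I_L.+1} -> R) c :
    measurable_fun Om (fun x => (v c * \1_(cell c) x : R)%:E).
  apply/measurable_EFinP; apply: measurable_funM => //.
have mcode (v : {ffun T -> 'I_L.+1} -> R) : measurable_fun Om (fun x => (v (code x))%:E).
  apply: (eq_measurable_fun (fun x => \sum_c (v c * \1_(cell c) x : R)%R%:E)%E).
    by move=> x; rewrite inE => Omx; rewrite sumEFin -code_sum.
  by apply: emeasurable_sum => c; exact: mind.
have int_code (v : {ffun T -> 'I_L.+1} -> R) : (forall c, 0 <= v c) ->
    (\int[mu]_(x in Om) (v (code x))%:E = (\sum_c w c * v c)%:E)%E.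
  move=> v0.
  rewrite (eq_integral (fun x => \sum_c (v c * \1_(cell c) x : R)%R%:E)%E); last first.
    by move=> x; rewrite inE => Omx; rewrite sumEFin -code_sum.
  rewrite ge0_integral_sum//; last first.
    by move=> c x _; rewrite lee_fin mulr_ge0.
  rewrite -sumEFin; apply: eq_bigr => c _.
  under eq_integral do rewrite EFinM.
  rewrite ge0_integralZl ?lee_fin//.
    rewrite integral_indic// EFinM muleC -wE; congr (mu _ * _)%E.
    by rewrite setIC setIA setIid.
  by apply/measurable_EFinP; exact: measurable_indic.
(* An empty cell has weight 0 and receives the default point [x0], which still lies in [Om]. *)
pose pt c := if pselect (exists x, cell c x) is left H then projT1 (cid H) else x0.
have Ompt c : Om (pt c).
  by rewrite /pt; case: pselect => // H; case: (projT2 (cid H)).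
have code_pt x : Om x -> code (pt (code x)) = code x.
  move=> Omx; apply/cellP => //; rewrite /pt; case: pselect => [H|[]].
    exact: (projT2 (cid H)).
  by exists x; apply/cellP.
(* Two points of one cell have their [h t] values in a common half-open interval of length [e]. *)
have close t x : Om x -> `|h t x - h t (pt (code x))| <= e.
  move=> Omx.
  have b y : Om y -> (code y t)%:R * e <= h t y < (code y t).+1%:R * e.
    move=> Omy; have /cellP : code y = code y by [].
    move=> /(_ Omy)[_ /(_ t Logic.I)[_ /=]].
    by rewrite in_itv.
  have /andP[b1 b2] := b x Omx; have /andP[b3 b4] := b (pt (code x)) (Ompt _).
  move: b3 b4; rewrite code_pt// => b3 b4.
  rewrite -natr1 in b2 b4; rewrite ler_norml; apply/andP; split; nra.
have w1 : \sum_c w c = 1.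
  have := int_code (fun=> 1) (fun=> ler01).
  under [in X in _ = X -> _]eq_bigr do rewrite mulr1.
  by rewrite integral_cst// muOm1 mul1e => -[].
exists {ffun T -> 'I_L.+1}, w, pt; split=> // t.
have hpt0 c : 0 <= h t (pt c) by have /andP[] := hM t _ (Ompt c).
have mht : measurable_fun Om (fun x => (h t x)%:E) by apply/measurable_EFinP.
set S := \sum_i _.
have up : (\int[mu]_(x in Om) (h t x)%:E <= (S + e)%:E)%E.
  have -> : S + e = \sum_c w c * (h t (pt c) + e).
    under [RHS]eq_bigr do rewrite mulrDr.
    by rewrite big_split /= -mulr_suml w1 mul1r.
  rewrite -(int_code (fun c => h t (pt c) + e)); last first.
    by move=> c; rewrite addr_ge0// ltW.
  apply: ge0_le_integral => //.
  - by move=> x Omx; rewrite lee_fin; have /andP[] := hM t x Omx.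
  - exact: (mcode (fun c => h t (pt c) + e)).
  - by move=> x Omx; rewrite lee_fin; have := close t x Omx; rewrite ler_norml; lra.
have lo : (S%:E <= \int[mu]_(x in Om) (h t x)%:E + e%:E)%E.
  rewrite -(int_code (fun c => h t (pt c)))//.
  have -> : e%:E = (\int[mu]_(x in Om) cst e%:E x)%E.
    by rewrite integral_cst// muOm1 mule1.
  rewrite -ge0_integralD//.
  - apply: ge0_le_integral => //.
    + by move=> x Omx; rewrite lee_fin.
    + exact: (mcode (fun c => h t (pt c))).
    + exact: emeasurable_funD.
    + move=> x Omx; rewrite -EFinD lee_fin.
      by have := close t x Omx; rewrite ler_norml; lra.
  - by move=> x Omx; rewrite lee_fin; have /andP[] := hM t x Omx.
  - by move=> x _; rewrite lee_fin ltW.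
have fin : (\int[mu]_(x in Om) (h t x)%:E)%E \is a fin_num.
  rewrite ge0_fin_numE; first exact: le_lt_trans up (ltry _).
  by apply: integral_ge0 => x Omx; rewrite lee_fin; have /andP[] := hM t x Omx.
move: up lo; rewrite -(fineK fin) -EFinD !lee_fin => up lo.
by rewrite ler_norml; lra.
Qed.

End Discretization.

(** * Inequalities for powers and the entropy sum *)

Section RealEstimates.
Variable R : realType.
Implicit Types (a b q D : R) (N K k : nat).

(* Young's inequality applied to [b] and [a ^ (q - 1)]. *)
Lemma powR_sub_le q a b : 1 < q -> 0 <= b -> b <= a ->
  a `^ q - b `^ q <= q * (a - b) * a `^ (q - 1).
Proof.
move=> q1 b0 ba; have a0 : 0 <= a := le_trans b0 ba.
have q0 : 0 < q by lra.
have := @conjugate_powR R b (a `^ (q - 1)) q (q / (q - 1)) b0 (powR_ge0 _ _) q0.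
rewrite divr_gt0; [|lra|lra]; rewrite -powRrM => /(_ isT).
have -> : (q - 1) * (q / (q - 1)) = q by field; lra.
have -> : q^-1 + (q / (q - 1))^-1 = 1 by field; lra.
move=> /(_ erefl) /(ler_wpM2l (ltW q0)).
have -> : q * (b `^ q / q + a `^ q / (q / (q - 1))) = b `^ q + (q - 1) * a `^ q.
  by field; apply/andP; split; lra.
rewrite -(mulr_powRB1 a0 q0); set u := a `^ (q - 1); nra.
Qed.

Lemma powR_eq1_eq1 q a : 0 < q -> 0 <= a -> a `^ q = 1 -> a = 1.
Proof.
move=> q0 a0 aq; rewrite -[LHS]powRr1// -[X in _ `^ X](mulfV (lt0r_neq0 q0)).
by rewrite powRrM aq powR1.
Qed.

Lemma half_scale_le a b : 0 < a -> `|b - 1| <= 1 / 2 ->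
  2^-1 * a <= a * b /\ a * b <= 3 / 2 * a.
Proof. by move=> a0; rewrite ler_norml => /andP[b1 b2]; split; nra. Qed.

Lemma dist_powR_le q D a b : 1 < q -> 0 <= a <= D -> 0 <= b <= D ->
  `|a `^ q - b `^ q| <= q * `|a - b| * D `^ (q - 1).
Proof.
move=> q1; wlog ba : a b / b <= a.
  move=> H; case: (leP b a) => [/H//|/ltW/H h ha hb].
  by rewrite distrC (distrC a); exact: h.
move=> /andP[a0 aD] /andP[b0 bD].
rewrite !ger0_norm ?subr_ge0 ?ge0_ler_powR ?nnegrE//; last lra.
apply: (le_trans (powR_sub_le q1 b0 ba)); apply: ler_wpM2l.
  by rewrite mulr_ge0 ?subr_ge0//; lra.
by apply: ge0_ler_powR; rewrite ?nnegrE//; lra.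
Qed.

(** For [b <= a], [powR_sub_le] bounds the square by [q^2 (a - b)^2 a^(2q - 2)], and
    [a^(2q - 2) <= D^(q - 2) a^q]. The surviving factor [a^q] lets the empirical [q]-norms control
    the increments. *)
Lemma sqr_dist_powR_le q D a b : 2 < q -> 0 <= a <= D -> 0 <= b <= D ->
  (a `^ q - b `^ q) ^+ 2 <= (q * (D `^ ((q - 2) / 2) * `|a - b|)) ^+ 2 * (a `^ q + b `^ q).
Proof.
move=> q2; wlog ba : a b / b <= a.
  move=> H; case: (leP b a) => [/H//|/ltW/H h ha hb].
  by have := h hb ha; rewrite -sqrrN opprB (distrC b) (addrC (b `^ q)).
move=> /andP[a0 aD] /andP[b0 bD].
have q1 : 1 < q by lra.
have h := powR_sub_le q1 b0 ba.
have h0 : 0 <= a `^ q - b `^ q.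
  by rewrite subr_ge0 ge0_ler_powR ?nnegrE//; lra.
have ab : 0 <= a - b by lra.
have hsq : (a `^ q - b `^ q) ^+ 2 <= (q * (a - b)) ^+ 2 * (a `^ (q - 1)) ^+ 2.
  by rewrite -exprMn ler_sqr ?nnegrE// mulr_ge0 ?powR_ge0// mulr_ge0//; lra.
apply: (le_trans hsq); rewrite (ger0_norm ab).
have -> : (q * (D `^ ((q - 2) / 2) * (a - b))) ^+ 2 * (a `^ q + b `^ q) =
  (q * (a - b)) ^+ 2 * (D `^ ((q - 2) / 2) ^+ 2 * (a `^ q + b `^ q)) by ring.
apply: ler_wpM2l; first exact: sqr_ge0.
have sqD (x r : R) : 0 <= x -> (x `^ r) ^+ 2 = x `^ (r * 2).
  by move=> x0; rewrite powRrM powR_mulrn ?powR_ge0.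
rewrite !sqD; [|lra|lra].
have -> : (q - 2) / 2 * 2 = q - 2 by field.
apply: (@le_trans _ _ (D `^ (q - 2) * a `^ q)); last first.
  by apply: ler_wpM2l; rewrite ?powR_ge0// lerDl powR_ge0.
move: a0; rewrite le_eqVlt => /orP[/eqP<-|a0].
  by rewrite !powR0 ?mulr0//; apply/eqP; lra.
have -> : (q - 1) * 2 = (q - 2) + q by ring.
rewrite powRD; last by rewrite (gt_eqF a0) implybT.
apply: ler_wpM2r; first exact: powR_ge0.
by apply: ge0_ler_powR; rewrite ?nnegrE//; lra.
Qed.

(** For integer [k], [k <= log2 N] means [k <= trunc_log 2 N]. At equality [2 ^ k = N] the larger of
    the two bounds, 1 rather than 1/2, is taken. *)
Definition entropy_bound N q k : R :=
  if (k <= trunc_log 2 N)%N then (N%:R / 2 ^+ k) `^ q^-1 else 2 `^ (- (2 ^+ k) / N%:R).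

Lemma entropy_bound_gt0 N q k : (0 < N)%N -> 0 < entropy_bound N q k.
Proof.
move=> N0; rewrite /entropy_bound; case: ifP => _; apply: powR_gt0 => //.
by rewrite divr_gt0 ?ltr0n// exprn_gt0.
Qed.

Lemma ln2_ge_half : 2^-1 <= ln 2 :> R.
Proof.
rewrite -ler_expR lnK ?posrE//.
have := expR_ge1Dx (- 2^-1 : R); rewrite expRN => h.
have e0 := expR_gt0 (2^-1 : R).
have : expR (2^-1) * (expR (2^-1))^-1 = 1 :> R by rewrite divff ?gt_eqF.
set u := expR _ in h e0 *; set v := u^-1 in h *; nra.
Qed.

(** The terms are geometric of ratio [r = 2^(1/2 - 1/q)]. Splitting off the last one, at most
    [sqrt N], leaves [(r^n - 1) / (r - 1)] with [r^n <= N^(1/2 - 1/q)], which produces the numerator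
    of the bound. *)
Lemma sum_entropy_head N q : (0 < N)%N -> 2 < q ->
  \sum_(k < (trunc_log 2 N).+1) Num.sqrt 2 ^+ k * (N%:R / 2 ^+ k) `^ q^-1
    <= 2 * ((N%:R `^ 2^-1 - N%:R `^ q^-1) / (2^-1 - q^-1)) + Num.sqrt N%:R.
Proof.
move=> N0 q2; set n := trunc_log 2 N.
have N0' : 0 < N%:R :> R by rewrite ltr0n.
have qi : q^-1 < 2^-1 by rewrite ltf_pV2 ?posrE//; lra.
pose al : R := 2^-1 - q^-1.
have al0 : 0 < al by rewrite subr_gt0.
pose r : R := 2 `^ al.
have rk k : r ^+ k = (2 ^+ k) `^ al.
  by rewrite -powR_mulrn ?powR_ge0// /r -!powRrM mulrC powRrM powR_mulrn.
have term k : Num.sqrt 2 ^+ k * (N%:R / 2 ^+ k) `^ q^-1 = N%:R `^ q^-1 * r ^+ k.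
  have k0 : 0 < 2 ^+ k :> R by rewrite exprn_gt0.
  rewrite powRM ?invr_ge0 ?(ltW N0') ?(ltW k0)// rk powRB; last first.
    by rewrite (gt_eqF k0) implybT.
  have -> : ((2 ^+ k)^-1 : R) `^ q^-1 = ((2 ^+ k) `^ q^-1)^-1.
    by rewrite -powR_inv1 ?(ltW k0)// -powRrM mulN1r powRN.
  have -> : Num.sqrt 2 ^+ k = (2 ^+ k) `^ (2^-1) :> R.
    rewrite powR12_sqrt ?(ltW k0)//; apply/eqP.
    rewrite -(eqrXn2 (n := 2)) ?exprn_ge0 ?sqrtr_ge0//.
    by rewrite sqr_sqrtr ?(ltW k0)// -exprM mulnC exprM sqr_sqrtr.
  by rewrite mulrCA.
under eq_bigr do rewrite term.
rewrite -mulr_sumr big_ord_recr /= mulrDr.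
have rn : r ^+ n <= N%:R `^ al.
  rewrite rk ge0_ler_powR ?nnegrE ?exprn_ge0//; first exact: ltW.
  by rewrite -natrX ler_nat trunc_logP.
have NqNal : N%:R `^ q^-1 * N%:R `^ al = N%:R `^ 2^-1.
  rewrite -powRD ?(gt_eqF N0') ?implybT//; congr (_ `^ _); rewrite /al; ring.
apply: lerD; last first.
  by rewrite -powR12_sqrt ?(ltW N0')// -NqNal ler_wpM2l ?powR_ge0.
(* [2^al - 1 >= al ln 2], so the geometric sum costs only [2 / al], also for [q] near 2. *)
have r1 : al / 2 <= r - 1.
  rewrite /r /powR gt_eqF//; have := expR_ge1Dx (al * ln 2).
  by have := ler_wpM2l (ltW al0) ln2_ge_half; lra.
have geo : (r - 1) * \sum_(i < n) r ^+ i = r ^+ n - 1.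
  by rewrite subrX1.
have G0 : 0 <= N%:R `^ al - 1.
  by rewrite subr_ge0 -[leLHS](powRr0 N%:R) ler_powR ?ler1n ?ltW.
have -> : (N%:R `^ 2^-1 - N%:R `^ q^-1) / al = N%:R `^ q^-1 * ((N%:R `^ al - 1) / al).
  by rewrite -NqNal; ring.
rewrite mulrCA ler_wpM2l ?powR_ge0// mulrA ler_pdivlMr//.
have S0 : 0 <= \sum_(i < n) r ^+ i by apply: sumr_ge0 => i _; rewrite exprn_ge0 ?powR_ge0.
move: geo S0; set S := \sum_(i < n) _; nra.
Qed.

(** Since [2^(n + 1) >= N] for [n = trunc_log 2 N], and [2^j >= j + 1], the entropy factor at
    [n + 1 + j] is at most [2^-(j + 1)]. A geometric series of ratio [1 / sqrt 2 <= 3/4] remains. *)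
Lemma sum_entropy_tail N K : (0 < N)%N ->
  \sum_(j < K) Num.sqrt 2 ^+ ((trunc_log 2 N).+1 + j)
      * 2 `^ (- (2 ^+ ((trunc_log 2 N).+1 + j)) / N%:R) <= 3 * Num.sqrt N%:R :> R.
Proof.
move=> N0; set n := trunc_log 2 N.
have N0' : 0 < N%:R :> R by rewrite ltr0n.
pose s : R := Num.sqrt 2.
have s0 : 0 < s by rewrite sqrtr_gt0.
have s2 : s ^+ 2 = 2 by rewrite sqr_sqrtr.
have s43 : 4 / 3 <= s by nra.
have sn : s ^+ n <= Num.sqrt N%:R.
  rewrite -(@ler_pXn2r _ 2) ?nnegrE ?exprn_ge0 ?sqrtr_ge0//.
  by rewrite (sqr_sqrtr (ltW N0')) -exprM mulnC exprM s2 -natrX ler_nat trunc_logP.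
have term j : s ^+ (n.+1 + j) * 2 `^ (- (2 ^+ (n.+1 + j)) / N%:R)
    <= Num.sqrt N%:R * s^-1 ^+ j.+1.
  apply: (@le_trans _ _ (s ^+ (n.+1 + j) * 2 `^ (- j.+1%:R))).
    apply: ler_wpM2l; first by rewrite exprn_ge0 ?sqrtr_ge0.
    apply: ler_powR; first lra.
    rewrite mulNr lerN2 ler_pdivlMr// exprD mulrC.
    apply: ler_pM => //; first by rewrite -natrX ler_nat ltnW// trunc_log_ltn.
    by rewrite -natrX ler_nat ltn_expl.
  rewrite powRN powR_mulrn// addSnnS exprD -mulrA ler_pM ?exprn_ge0 ?mulr_ge0 ?invr_ge0 ?exprn_ge0 ?(ltW s0)//.
  by rewrite -s2 -exprM mulnC exprM exprVn expr2 invfM mulrA divff ?mul1r ?expf_neq0 ?gt_eqF.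
apply: (@le_trans _ _ (\sum_(j < K) Num.sqrt N%:R * s^-1 ^+ j.+1)).
  by apply: ler_sum => j _; exact: term.
rewrite -mulr_sumr mulrC ler_wpM2r ?sqrtr_ge0//.
have si0 : 0 < s^-1 by rewrite invr_gt0.
have si : s^-1 <= 3 / 4.
  by rewrite -[leRHS]invrK lef_pV2 ?posrE//; lra.
suff : \sum_(j < K) s^-1 ^+ j.+1 <= 3 * (1 - s^-1 ^+ K).
  by have := exprn_ge0 K (ltW si0); lra.
elim: K => [|k IH]; first by rewrite big_ord0 expr0 subrr mulr0.
rewrite big_ord_recr /= exprS.
by have := exprn_ge0 k (ltW si0); set u := _ ^+ k in IH *; nra.
Qed.

Lemma sum_entropy N q K : (0 < N)%N -> 2 < q ->
  \sum_(k < K) Num.sqrt 2 ^+ k * entropy_bound N q k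
    <= 2 * ((N%:R `^ 2^-1 - N%:R `^ q^-1) / (2^-1 - q^-1)) + 4 * Num.sqrt N%:R.
Proof.
move=> N0 q2; set n := trunc_log 2 N.
have ge0 k : 0 <= Num.sqrt 2 ^+ k * entropy_bound N q k.
  by rewrite mulr_ge0 ?exprn_ge0 ?sqrtr_ge0// ltW// entropy_bound_gt0.
(* Nonnegative terms are added so that the sum can be cut at [n.+1] even if [K] is smaller. *)
apply: (@le_trans _ _ (\sum_(k < n.+1 + K) Num.sqrt 2 ^+ k * entropy_bound N q k)).
  rewrite addnC big_split_ord /= lerDl; exact: sumr_ge0.
rewrite big_split_ord /=.
have := lerD (sum_entropy_head N0 q2) (sum_entropy_tail K N0); rewrite -/n => h.
have -> : 4 * Num.sqrt N%:R = Num.sqrt N%:R + 3 * Num.sqrt N%:R :> R by ring.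
rewrite addrA; apply: le_trans h; rewrite le_eqVlt; apply/orP; left; apply/eqP.
congr (_ + _); apply: eq_bigr => k _; rewrite /entropy_bound -/n.
  by rewrite -ltnS ltn_ord.
by rewrite leqNgt addSn ltnS leq_addr.
Qed.

End RealEstimates.

(** * Discretization for a bounded class with given nets *)

Section NetDiscretization.
Variables (R : realType) (disp : measure_display) (X : measurableType disp).
Variables (mu : probability X R) (Om : set X) (mOm : measurable Om) (muOm : mu Om = 1%E).

Definition mean (h : X -> R) : R := fine (\int[mu]_(x in Om) (h x)%:E).

Lemma integral_bounded_fin_num (h : X -> R) (M : R) : measurable_fun Om h ->
  (forall x, Om x -> 0 <= h x <= M) -> (\int[mu]_(x in Om) (h x)%:E)%E \is a fin_num.
Proof.
move=> mh hM; have h0 x : Om x -> (0 <= (h x)%:E)%E.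
  by move=> /hM/andP[]; rewrite lee_fin.
rewrite ge0_fin_numE; last exact: integral_ge0.
apply: (@le_lt_trans _ _ (\int[mu]_(x in Om) cst M%:E x)%E).
  apply: ge0_le_integral => //; first exact/measurable_EFinP.
  by move=> x /hM/andP[_]; rewrite lee_fin.
rewrite integral_cst//.
have -> : (mu : {measure set X -> \bar R}) Om = 1%E by [].
by rewrite mule1 ltry.
Qed.

(** Quadrature for the pair [f], [g] reduces the claim to finite averages, so no integral of a
    signed difference is formed. *)
Lemma mean_close (f g : X -> R) (M e : R) :
  measurable_fun Om f -> measurable_fun Om g ->
  (forall x, Om x -> 0 <= f x <= M) -> (forall x, Om x -> 0 <= g x <= M) ->
  (forall x, Om x -> `|f x - g x| <= e) -> `|mean f - mean g| <= e.
Proof.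
move=> mf mg fM gM fg; apply/ler_addgt0Pr => d d0.
have d2 : 0 < d / 2 by rewrite divr_gt0.
pose h (b : bool) := if b then f else g.
have mh b : measurable_fun Om (h b) by case: b.
have hM b x : Om x -> 0 <= h b x <= M by case: b => [/fM|/gM].
have [J [w [pt [Opt w0 w1 hq]]]] := finite_quadrature mOm muOm mh hM d2.
have : `|\sum_i w i * f (pt i) - \sum_i w i * g (pt i)| <= e.
  rewrite -sumrB; apply: (le_trans (ler_norm_sum _ _ _)).
  rewrite -[leRHS]mul1r -w1 mulr_suml; apply: ler_sum => i _.
  by rewrite -mulrBr normrM ger0_norm// ler_wpM2l// fg.
have := hq true; have := hq false; rewrite /= -/(mean f) -/(mean g) !ler_norml; lra.
Qed.

(** The error budget of [net_discretization]: [a] and [b] are the means for a function and for its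
    net approximation, [e] and [f] their empirical means, [c] the quadrature of the approximation.
    The total is 7/16. *)
Lemma dist_sub_le (a b c e f : R) : `|a - b| <= 1 / 16 -> `|e - f| <= 1 / 16 ->
  `|b - c| <= 1 / 16 -> `|f - c| <= 1 / 4 -> `|e - a| <= 1 / 2.
Proof. by rewrite !ler_norml; lra. Qed.

(** [finite_sampling] is applied to the [q]-th powers of the net functions, with [T] the index set
    of the finest net. The level-0 net must vanish, as the chain starts from zero. *)
Lemma net_discretization (A : set (X -> R)) (q D : R) (rho : nat -> R) (m : nat) :
  2 < q -> (0 < m)%N ->
  (forall f, A f -> measurable_fun Om f) ->
  (forall f x, A f -> Om x -> `|f x| <= D) ->
  (forall f, A f -> mean (fun x => `|f x| `^ q) <= 1) ->
  (forall k, 0 < rho k) ->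
  (forall k, exists F : 'I_(Nent k) -> X -> R,
    [/\ forall u, A (F u), k = 0 -> forall u x, F u x = 0 &
      forall f, A f -> exists u, forall x, Om x -> `|F u x - f x| <= rho k]) ->
  (forall e, 0 < e -> exists K, rho K <= e) ->
  (forall K, 240 * \sum_(k < K) Num.sqrt 2 ^+ k *
      (q * (D `^ ((q - 2) / 2) * (rho k + rho k.+1))) <= Num.sqrt m%:R) ->
  0 < D ->
  exists xi : 'I_m -> X, (forall j, Om (xi j)) /\
    forall f, A f ->
      `|m%:R^-1 * \sum_j `|f (xi j)| `^ q - mean (fun x => `|f x| `^ q)| <= 1 / 2.
Proof.
move=> q2 m0 mA AD A1 rho0 nets small hsum D0.
have q0 : 0 < q by lra.
have q1 : 1 < q by lra.
pose Dq := D `^ (q - 1).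
have Dq0 : 0 < Dq by exact: powR_gt0.
(* The finest level is chosen so that a sup-distance [2 rho K] changes [q]-th powers by at most
   1/16. *)
have [K rhoK] := small ((32 * (q * Dq))^-1) ltac:(by rewrite invr_gt0 !mulr_gt0).
have err : q * (rho K + rho K) * Dq <= 1 / 16.
  move: rhoK; rewrite -[leRHS]div1r ler_pdivlMr ?mulr_gt0//; nra.
pose F k := projT1 (cid (nets k)).
have FA k u : A (F k u) by rewrite /F; case: (cid _) => ? [].
have F0 u x : F 0 u x = 0 by rewrite /F; case: (cid _) => ? [/= _ /(_ erefl)].
have Fnet k f : A f -> exists u, forall x, Om x -> `|F k u x - f x| <= rho k.
  by move=> Af; rewrite /F; case: (cid _) => ? [/= _ _]; apply.
(* Even for [k = K] the chosen centre may differ from [t] itself, whence the distance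
   [rho K + rho K] in [near]. *)
pose p k (t : 'I_(Nent K)) := projT1 (cid (Fnet k (F K t) (FA K t))).
have pP k t x : Om x -> `|F k (p k t) x - F K t x| <= rho k.
  by move=> Omx; rewrite /p; case: (cid _) => /= u; exact.
have near f : A f -> exists t, forall x, Om x -> `|f x - F K (p K t) x| <= rho K + rho K.
  move=> Af; have [t ft] := Fnet K f Af; exists t => x Omx.
  by have := ft x Omx; have := pP K t x Omx; rewrite !ler_norml; lra.
have absAD f x : A f -> Om x -> 0 <= `|f x| <= D.
  by move=> Af Omx; rewrite normr_ge0 AD.
have powclose f g x r : A f -> A g -> Om x -> `|f x - g x| <= r ->
    `| `|f x| `^ q - `|g x| `^ q | <= q * r * Dq.
  move=> Af Ag Omx fg; apply: (le_trans (dist_powR_le q1 (absAD f x Af Omx) (absAD g x Ag Omx))).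
  rewrite ler_wpM2r ?(ltW Dq0)// ler_wpM2l ?(ltW q0)//.
  exact: le_trans (ler_dist_dist _ _) fg.
have mpow f : A f -> measurable_fun Om (fun x => `|f x| `^ q).
  move=> Af; apply: (measurableT_comp (measurable_powR q)).
  by apply: measurableT_comp => //; exact: mA.
have powbd f x : A f -> Om x -> 0 <= `|f x| `^ q <= D `^ q.
  move=> Af Omx; rewrite powR_ge0/= ge0_ler_powR ?nnegrE ?(ltW q0) ?(ltW D0)//.
  exact: AD.
have [J [w [pt [Opt w0 w1 hq]]]] :=
  @finite_quadrature _ X R mu Om 'I_(Nent K) (fun t x => `|F K (p K t) x| `^ q) (D `^ q)
    (1 / 16) mOm muOm (fun t => mpow _ (FA K _)) (fun t x => powbd _ _ (FA K _)) ltac:(lra).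
have Nent_gt0 : (0 < Nent K)%N by rewrite /Nent; case: (K) => // ?; rewrite expn_gt0.
have [x xP] : exists x : {ffun 'I_m -> J}, forall t,
    `|m%:R^-1 * \sum_j `|F K (p K t) (pt (x j))| `^ q
      - \sum_i w i * `|F K (p K t) (pt i)| `^ q| <= 1 / 4.
  apply: (@finite_sampling R J 'I_(Nent K) (Ordinal Nent_gt0) w m K
    (fun k u i => `|F k u (pt i)| `^ q) p
    (fun k => q * (D `^ ((q - 2) / 2) * (rho k + rho k.+1))) w0 w1 m0).
  - by move=> u i; rewrite F0 normr0 powR0// gt_eqF.
  - by move=> k; rewrite !mulr_gt0 ?powR_gt0 ?addr_gt0.
  - move=> k t kK; have [t' ft'] := near _ (FA k (p k t)).
    exists t' => i; have := powclose _ _ _ _ (FA k (p k t)) (FA K (p K t')) (Opt i) (ft' _ (Opt i)).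
    by rewrite ler_norml; lra.
  - by move=> t; have := hq t; have := A1 _ (FA K (p K t)); rewrite /mean ler_norml; lra.
  - move=> k t i kK.
    apply: (le_trans (sqr_dist_powR_le q2 (absAD _ _ (FA _ _) (Opt i)) (absAD _ _ (FA _ _) (Opt i)))).
    rewrite ler_wpM2r ?addr_ge0 ?powR_ge0// ler_sqr ?nnegrE.
    + rewrite ler_wpM2l ?(ltW q0)// ler_wpM2l ?powR_ge0//.
      apply: (le_trans (ler_dist_dist _ _)).
      by have := pP k t _ (Opt i); have := pP k.+1 t _ (Opt i); rewrite !ler_norml; lra.
    + by rewrite !mulr_ge0 ?powR_ge0 ?(ltW q0).
    + by rewrite !mulr_ge0 ?powR_ge0 ?(ltW q0)// addr_ge0// ltW.
  - exact: hsum.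
exists (fun j => pt (x j)); split=> // f Af.
have [t ft] := near f Af.
have h1 : `|mean (fun x => `|f x| `^ q) - mean (fun x => `|F K (p K t) x| `^ q)| <= 1 / 16.
  apply: (mean_close (mpow _ Af) (mpow _ (FA K _)) (fun x => powbd f x Af)
    (fun x => powbd _ x (FA K _))) => y Oy.
  exact: le_trans (powclose _ _ _ _ Af (FA K _) Oy (ft y Oy)) err.
have h2 : `|m%:R^-1 * \sum_j `|f (pt (x j))| `^ q
         - m%:R^-1 * \sum_j `|F K (p K t) (pt (x j))| `^ q| <= 1 / 16.
  rewrite -mulrBr -sumrB normrM ger0_norm ?invr_ge0 ?ler0n//.
  rewrite ler_pdivrMl ?ltr0n//; apply: (le_trans (ler_norm_sum _ _ _)).
  rewrite mulr_natl -[m in leRHS]card_ord -sumr_const; apply: ler_sum => j _.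
  exact: le_trans (powclose _ _ _ _ Af (FA K _) (Opt _) (ft _ (Opt _))) err.
exact: dist_sub_le h1 h2 (hq t) (xP t).
Qed.

End NetDiscretization.

(** * From entropy numbers to the chaining condition *)

Section EntropyEstimates.
Variable R : realType.

(** Beyond [log2 N] the bound is [2^-y] with [y = 2^K / N], and [2^y >= 1 + y ln 2 >= y / 2] gives
    [2^-y <= 2 / y]. *)
Lemma entropy_bound_small (N : nat) (q e : R) : (0 < N)%N -> 0 < e ->
  exists K, entropy_bound N q K <= e.
Proof.
move=> N0 e0; have N0' : 0 < N%:R :> R by rewrite ltr0n.
pose K := maxn (trunc_log 2 N).+1 (Num.truncn (2 * N%:R / e)).+1.
exists K; rewrite /entropy_bound leqNgt leq_maxl /=.
set y : R := 2 ^+ K / N%:R.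
have y0 : 0 < y by rewrite divr_gt0// exprn_gt0.
rewrite mulNr powRN; apply: (@le_trans _ _ (2 / y)).
  rewrite -[leRHS]invrK lef_pV2 ?posrE ?powR_gt0 ?invr_gt0 ?divr_gt0//.
  rewrite invf_div /powR gt_eqF//.
  have := expR_ge1Dx (y * ln 2); have := ler_wpM2l (ltW y0) (ln2_ge_half R); lra.
rewrite ler_pdivrMr// -ler_pdivrMl// mulrC /y ler_pdivlMr//.
have : 2 * N%:R / e < K%:R.
  by rewrite (lt_le_trans (truncnS_gt _))// ler_nat leq_maxr.
have : K%:R <= 2 ^+ K :> R by rewrite -natrX ler_nat ltnW// ltn_expl.
by rewrite mulrAC; lra.
Qed.

(** The infimum need not be attained, so a net is available only at radii strictly above the
    bound. *)
Lemma entropy_number_net (T : Type) (A : set T) (dist : T -> T -> R) k (b r : R) :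
  (entropy_number A dist k <= b%:E)%E -> b < r ->
  exists F : 'I_(Nent k) -> T,
    (forall j, A (F j)) /\ (forall g, A g -> exists j, dist (F j) g < r).
Proof.
move=> Ab br; have /ereal_inf_lt[_ [e [F [FA Fe]] <-]] : (entropy_number A dist k < r%:E)%E.
  by apply: le_lt_trans Ab _; rewrite lte_fin.
rewrite lte_fin => er; exists F; split=> // g /Fe[j ej].
by exists j; exact: lt_trans er.
Qed.

(** With [S = max(G, sqrt N)] each of the two entropy sums is at most [6 S], so the left side is at
    most [240 * 24 q Y B S]. Squaring and [(Y B)^2 = B^q N^(1 - 2/q)] give the condition on [m]. *)
Lemma chaining_sum_le (C : R) (N m K : nat) (q B : R) : 240 * 24 <= C -> (0 < N)%N -> 2 < q -> 0 < B ->
  C ^+ 2 * q ^+ 2 * B `^ q * N%:R `^ (1 - 2 / q) *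
    Num.max (((N%:R `^ 2^-1 - N%:R `^ q^-1) / (2^-1 - q^-1)) ^+ 2) N%:R <= m%:R ->
  240 * \sum_(k < K) Num.sqrt 2 ^+ k *
    (q * ((B * N%:R `^ q^-1) `^ ((q - 2) / 2) *
      (2 * B * entropy_bound N q k + 2 * B * entropy_bound N q k.+1))) <= Num.sqrt m%:R.
Proof.
move=> hC N0 q2 B0; have N0' : 0 < N%:R :> R by rewrite ltr0n.
have qi : q^-1 < 2^-1 by rewrite ltf_pV2 ?posrE//; lra.
set G := (_ - _) / _ => hm.
have G0 : 0 <= G.
  apply: divr_ge0; last by rewrite subr_ge0 ltW.
  by rewrite subr_ge0 ler_powR ?ler1n ?ltW.
pose S := Num.max G (Num.sqrt N%:R).
have S2 : S ^+ 2 = Num.max (G ^+ 2) N%:R.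
  have sN : Num.sqrt N%:R ^+ 2 = N%:R :> R by rewrite sqr_sqrtr// ltW.
  rewrite /S /Num.max -[in RHS]sN ltr_sqr ?nnegrE ?sqrtr_ge0//.
  by case: ifP.
have [SG SN] : G <= S /\ Num.sqrt N%:R <= S by rewrite !le_max !lexx orbT.
have S0 : 0 <= S := le_trans G0 SG.
set E := entropy_bound N q.
have E0 k : 0 <= E k by rewrite ltW// entropy_bound_gt0.
pose s : R := Num.sqrt 2.
have s1 : 1 <= s by rewrite -[leLHS]sqrtr1 ler_sqrt// ler1n.
have sk k : 0 <= s ^+ k by rewrite exprn_ge0// (le_trans ler01).
set Y := (B * _) `^ _.
have Y0 : 0 <= Y by exact: powR_ge0.
have Y2 : (Y * B) ^+ 2 = B `^ q * N%:R `^ (1 - 2 / q).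
  rewrite exprMn -[Y ^+ 2]powR_mulrn// /Y -powRrM divfK//.
  rewrite powRM ?powR_ge0 ?(ltW B0)// mulrAC -[B ^+ 2]powR_mulrn ?(ltW B0)//.
  rewrite -powRD ?(gt_eqF B0) ?implybT// -powRrM.
  by congr (_ `^ _ * _ `^ _); [ring|field; lra].
have sumE n : \sum_(k < n) s ^+ k * E k <= 6 * S.
  by apply: (le_trans (sum_entropy n N0 q2)); rewrite -/G; lra.
(* Shifting the index only enlarges the weight, from [s ^+ k] to [s ^+ k.+1]. *)
have sumE1 : \sum_(k < K) s ^+ k * E k.+1 <= 6 * S.
  apply: le_trans (sumE K.+1); rewrite big_ord_recl /= ler_wpDl ?mulr_ge0//.
  apply: ler_sum => k _; rewrite ler_wpM2r// /bump /= add1n exprS.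
  by rewrite ler_peMl.
have -> : \sum_(k < K) s ^+ k * (q * (Y * (2 * B * E k + 2 * B * E k.+1)))
   = 2 * q * (Y * B) * (\sum_(k < K) s ^+ k * E k + \sum_(k < K) s ^+ k * E k.+1).
  by rewrite -big_split /= mulr_sumr; apply: eq_bigr => k _; ring.
apply: (@le_trans _ _ (C * q * (Y * B) * S)).
  have YB : 0 <= 2 * q * (Y * B) by rewrite !mulr_ge0 ?(ltW B0)//; lra.
  have h1 := ler_wpM2l YB (lerD (sumE K) sumE1).
  have YBS : 0 <= q * (Y * B) * S by rewrite !mulr_ge0 ?(ltW B0)//; lra.
  have h2 := ler_wpM2r YBS hC.
  move: h1 h2; rewrite -/E -/s; set u := \sum_(k < K) _ + _.
  by lra.
rewrite -(@ler_pXn2r _ 2) ?nnegrE ?sqrtr_ge0//; last first.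
  by rewrite !mulr_ge0 ?(ltW B0)//; lra.
rewrite sqr_sqrtr ?ler0n//; apply: le_trans hm.
by rewrite -S2 exprMn exprMn Y2 exprMn !mulrA.
Qed.

End EntropyEstimates.

(** * Measurability, sup norm and homogeneity on compact subsets *)

Section BorelRd.
Variables (R : realType) (d : nat).

Lemma closed_measurable_Rd (A : set 'rV[R]_d) : closed A -> measurable (A : set (Borel_Rd R d)).
Proof.
move=> cA; rewrite -[A]setCK; apply: measurableC; apply: sub_sigma_algebra.
exact: closed_openC.
Qed.

Lemma within_continuous_measurable_Rd (A : set 'rV[R]_d) (f : 'rV[R]_d -> R) :
  closed A -> {within A, continuous f} -> measurable_fun (A : set (Borel_Rd R d)) f.
Proof.
move=> cA /continuousP cf.
apply: (measurability _ (RGenOpens.measurableE R)) => _ [_ [a [b ->] <-]].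
have oab : open (`]a, b[%classic : set R) by exact: interval_open.
have /open_subspaceP[U oU UA] := cf _ oab.
rewrite setIC -UA; apply: measurableI; last exact: closed_measurable_Rd.
exact: sub_sigma_algebra.
Qed.

Lemma span_fun_bounded_measurable (N : nat) (Om : set 'rV[R]_d)
    (phi : 'I_N -> 'rV[R]_d -> R) (f : 'rV[R]_d -> R) :
  compact Om -> (forall i, {within Om, continuous (phi i)}) -> span_fun phi f ->
  measurable_fun (Om : set (Borel_Rd R d)) f /\ exists M, forall x, Om x -> `|f x| <= M.
Proof.
move=> cOm cphi [c ->]; have clOm := compact_closed (@norm_hausdorff _ _) cOm.
have bphi i : exists M, forall x, Om x -> `|phi i x| <= M.
  have [M [_ hM]] := compact_bounded (continuous_compact (cphi i) cOm).
  exists (M + 1) => x Omx; apply: (hM (M + 1)); first by rewrite ltrDl.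
  by exists x.
have [M hM] := choice bphi; split.
  apply: measurable_sum => i; apply: measurable_funM => //.
  exact: within_continuous_measurable_Rd.
exists (\sum_i `|c i| * M i) => x Omx; apply: (le_trans (ler_norm_sum _ _ _)).
by apply: ler_sum => i _; rewrite normrM ler_wpM2l// hM.
Qed.

(** The bound [M] ensures that [sup] is a genuine least upper bound and not a default value. *)
Lemma sup_norm_ge (Om : set 'rV[R]_d) (f : 'rV[R]_d -> R) (M : R) x :
  (forall y, Om y -> `|f y| <= M) -> Om x -> `|f x| <= sup_norm Om f.
Proof.
move=> fM Omx; apply: ub_le_sup; last by exists x.
by exists M => _ [y Oy <-]; exact: fM.
Qed.

Lemma span_funZ (N : nat) (phi : 'I_N -> 'rV[R]_d -> R) (a : R) f :
  span_fun phi f -> span_fun phi (fun x => a * f x).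
Proof.
move=> [c ->]; exists (fun i => a * c i); apply/funext => x.
by rewrite mulr_sumr; apply: eq_bigr => i _; rewrite mulrA.
Qed.

Variables (mu : probability (Borel_Rd R d) R) (Om : set 'rV[R]_d) (q : R).
Hypotheses (mOm : measurable (Om : set (Borel_Rd R d)))
  (muOm : mu (Om : set (Borel_Rd R d)) = 1%E) (q0 : 0 < q).

Lemma Lq_norm_powR f :
  Lq_norm mu Om q f `^ q = @mean R _ (Borel_Rd R d) mu Om (fun x => `|f x| `^ q).
Proof.
rewrite /Lq_norm -powRrM mulVf ?gt_eqF// powRr1// fine_ge0//.
by apply: integral_ge0 => x _; rewrite lee_fin powR_ge0.
Qed.

(** Boundedness of [f] makes the integral finite, so that [fine] commutes with the product. *)
Lemma meanZ_powR (a M : R) (f : 'rV[R]_d -> R) :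
  measurable_fun (Om : set (Borel_Rd R d)) f -> (forall x, Om x -> `|f x| <= M) ->
  @mean R _ (Borel_Rd R d) mu Om (fun x => `|a * f x| `^ q)
    = `|a| `^ q * @mean R _ (Borel_Rd R d) mu Om (fun x => `|f x| `^ q).
Proof.
move=> mf fM.
have mp : measurable_fun (Om : set (Borel_Rd R d)) (fun x => `|f x| `^ q).
  by apply: (measurableT_comp (measurable_powR q)); exact: measurableT_comp.
rewrite /mean; under eq_integral do rewrite normrM powRM// EFinM.
rewrite ge0_integralZl ?lee_fin ?powR_ge0//; last exact/measurable_EFinP.
rewrite fineM//; apply: (@integral_bounded_fin_num _ _ _ _ _ mOm muOm _ (`|M| `^ q)) => // x Omx.
rewrite powR_ge0 ge0_ler_powR ?nnegrE ?(ltW q0)//.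
exact: le_trans (fM x Omx) (ler_norm _).
Qed.

Lemma Lq_normZ_powR (a M : R) (f : 'rV[R]_d -> R) :
  measurable_fun (Om : set (Borel_Rd R d)) f -> (forall x, Om x -> `|f x| <= M) ->
  Lq_norm mu Om q (fun x => a * f x) `^ q = `|a| `^ q * Lq_norm mu Om q f `^ q.
Proof.
move=> mf fM; apply: (etrans (Lq_norm_powR _)); apply: (etrans (meanZ_powR a mf fM)).
by congr (_ * _); apply/esym/Lq_norm_powR.
Qed.

End BorelRd.

(** * Assembly for the unit ball of the subspace *)

Unset Implicit Arguments.
Set Strict Implicit.

Theorem theorem4p4 (R : realType) :
  exists c : R, 0 < c /\
  forall (d : nat) (Omega : set 'rV[R]_d)
    (mu : probability (Borel_Rd R d) R) (q B : R) (N : nat)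
    (phi : 'I_N -> 'rV[R]_d -> R),
    compact Omega ->
    mu (Omega : set (Borel_Rd R d)) = 1%E ->
    2 < q -> 0 < B -> (0 < N)%N ->
    (forall i, {within Omega, continuous (phi i)}) ->
    (forall a : 'I_N -> R,
        (forall x, Omega x -> \sum_(i < N) a i * phi i x = 0) ->
        forall i, a i = 0) ->
    (forall k : nat,
      (k%:R <= log2 (N%:R : R) ->
         (entropy_number (Lq_ball mu Omega q phi)
            (fun f g => sup_norm Omega (fun x => (f x - g x)%R)) k
          <= (B * (N%:R / 2 ^+ k) `^ q^-1)%R%:E)%E) /\
      (log2 (N%:R : R) <= k%:R ->
         (entropy_number (Lq_ball mu Omega q phi)
            (fun f g => sup_norm Omega (fun x => (f x - g x)%R)) k
          <= (B * 2 `^ (- (2 ^+ k) / N%:R))%R%:E)%E)) ->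
    forall m : nat,
      c * q ^+ 2 * B `^ q * N%:R `^ (1 - 2 / q) *
        Num.max (((N%:R `^ 2^-1 - N%:R `^ q^-1) / (2^-1 - q^-1)) ^+ 2) N%:R
        <= m%:R ->
      exists xi : 'I_m -> 'rV[R]_d,
        (forall j, Omega (xi j)) /\
        forall f, span_fun phi f ->
          2^-1 * Lq_norm mu Omega q f `^ q
            <= m%:R^-1 * \sum_(j < m) `|f (xi j)| `^ q /\
          m%:R^-1 * \sum_(j < m) `|f (xi j)| `^ q
            <= 3 / 2 * Lq_norm mu Omega q f `^ q.
Proof.
(* The chaining condition compares with [sqrt m], so the constant for [m] is [C ^+ 2]; only the
   lower bound on [C] is used. *)
have [C C0 hC] : exists2 C : R, 0 < C & 240 * 24 <= C by exists (240 * 24); lra.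
exists (C ^+ 2); split; first exact: exprn_gt0.
move=> d Om mu q B N phi cOm muOm q2 B0 N0 cphi _ ent m hm.
have q0 : 0 < q by lra.
have N0' : 0 < N%:R :> R by rewrite ltr0n.
have mOm : measurable (Om : set (Borel_Rd R d)).
  by apply: closed_measurable_Rd; apply: compact_closed => //; exact: norm_hausdorff.
pose D := B * N%:R `^ q^-1.
have D0 : 0 < D by rewrite mulr_gt0 ?powR_gt0.
pose A := Lq_ball mu Om q phi.
have spanP f : span_fun phi f -> measurable_fun (Om : set (Borel_Rd R d)) f /\
    exists M, forall x, Om x -> `|f x| <= M.
  exact: span_fun_bounded_measurable.
have m0 : (0 < m)%N.
  rewrite -(ltr0n R); apply: lt_le_trans hm; apply: mulr_gt0.
    by rewrite !mulr_gt0 ?exprn_gt0 ?powR_gt0.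
  by rewrite lt_max N0' orbT.
have ln2 : 0 < ln 2 :> R by rewrite ln_gt0// ltr1n.
have entb k : (entropy_number A (fun f g => sup_norm Om (fun x => (f x - g x)%R)) k
    <= (B * entropy_bound N q k)%:E)%E.
  have [h1 h2] := ent k; rewrite /entropy_bound; case: leqP => kN.
    apply: h1; rewrite /log2 ler_pdivlMr// mulr_natl -lnXn// ler_ln ?posrE ?exprn_gt0//.
    by rewrite -natrX ler_nat (leq_trans _ (trunc_logP (isT : 1 < 2)%N N0))// leq_exp2l.
  apply: h2; rewrite /log2 ler_pdivrMr// mulr_natl -lnXn// ler_ln ?posrE ?exprn_gt0//.
  rewrite -natrX ler_nat ltnW// (leq_trans (trunc_log_ltn N (isT : 1 < 2)%N))//.
  by rewrite leq_exp2l.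
have dist_le f g x : A f -> A g -> Om x ->
    `|f x - g x| <= sup_norm Om (fun x => f x - g x).
  move=> [/spanP[_ [M fM]] _] [/spanP[_ [M' gM']] _] Omx.
  apply: (@sup_norm_ge _ _ _ (fun x => f x - g x) (M + M')) => // y Oy.
  by apply: (le_trans (ler_normB _ _)); rewrite lerD ?fM ?gM'.
have AN f : A f -> A (fun x => -1 * f x).
  move=> [sf Lf]; split; first exact: span_funZ.
  by rewrite /Lq_norm; under eq_integral do rewrite mulN1r normrN.
(* The level-0 net has a single centre, within [D + e] of both [f] and [-1 * f]; the triangle
   inequality gives [|f x| < D + e]. *)
have AD f x : A f -> Om x -> `|f x| <= D.
  move=> Af Omx; apply/ler_addgt0Pr => e e0.
  have De : B * entropy_bound N q 0 < D + e by rewrite /entropy_bound /= expr0 divr1 ltrDl.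
  have [F [FA FP]] := entropy_number_net (entb 0) De.
  have [u hu] := FP _ Af; have [v] := FP _ (AN _ Af).
  have -> : v = u by rewrite [u]ord1 [v]ord1.
  move=> hv; have := dist_le _ _ _ (FA u) Af Omx.
  have := dist_le _ _ _ (FA u) (AN _ Af) Omx.
  move=> /le_lt_trans/(_ hv) h1 /le_lt_trans/(_ hu) h2.
  by move: h1 h2; rewrite !ltr_norml ler_norml; lra.
(* The factor 2 leaves the strict room needed to extract nets from the entropy numbers. *)
pose rho k := 2 * B * entropy_bound N q k.
have rho0 k : 0 < rho k by rewrite !mulr_gt0 ?entropy_bound_gt0.
have [||||||||xi [Oxi xiP]] := @net_discretization R _ (Borel_Rd R d) mu Om mOm muOm
    A q D rho m q2 m0.
- by move=> f [/spanP[]].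
- exact: AD.
- move=> f [_ Lf]; rewrite -(@Lq_norm_powR R d mu Om q q0).
  have <- : 1 `^ q = 1 :> R by rewrite powR1.
  by apply: ge0_ler_powR; rewrite ?nnegrE ?powR_ge0 ?(ltW q0).
- exact: rho0.
- case=> [|k].
    (* The zero function serves as level-0 net, since [rho 0 = 2 D] exceeds the bound [D] on the
       ball. *)
    exists (fun _ _ => 0); split=> //.
      move=> _; split.
        by exists (fun=> 0); apply/funext => x; rewrite big1// => i _; rewrite mul0r.
      rewrite /Lq_norm; under eq_integral do rewrite normr0 powR0 ?gt_eqF//.
      by rewrite integral0 /= powR0// invr_eq0 gt_eqF.
    move=> f Af; exists ord0 => x Omx; rewrite sub0r normrN (le_trans (AD f x Af Omx))//.
    by rewrite /rho /entropy_bound /= expr0 divr1 -mulrA -/D; lra.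
  have Bk : B * entropy_bound N q k.+1 < rho k.+1.
    by rewrite /rho -mulrA; have := @entropy_bound_gt0 R N q k.+1 N0; nra.
  have [F [FA FP]] := entropy_number_net (entb k.+1) Bk.
  exists F; split=> // f Af; have [u hu] := FP _ Af; exists u => x Omx.
  exact: le_trans (dist_le _ _ _ (FA u) Af Omx) (ltW hu).
- move=> e e0; have e1 : 0 < e / (2 * B) by rewrite divr_gt0 ?mulr_gt0.
  have [K hK] := @entropy_bound_small R N q _ N0 e1.
  by exists K; rewrite /rho mulrC -ler_pdivlMr ?mulr_gt0.
- by move=> K; exact: (@chaining_sum_le R C N m K q B).
- exact: D0.
exists xi; split=> // f sf.
have [mf [M fM]] := spanP f sf.
set L := Lq_norm mu Om q f.
have LqZ a : Lq_norm mu Om q (fun x => a * f x) `^ q = `|a| `^ q * L `^ q.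
  exact: (@Lq_normZ_powR R d mu Om q mOm muOm q0 a M f mf fM).
have L0 : 0 <= L by exact: powR_ge0.
(* If the norm vanishes, all multiples of [f] lie in the ball. A nonzero value [f x] could then be
   scaled to [D + 1], against [AD]. *)
have [L1|L1] := eqVneq L 0.
  have fx0 x : Om x -> f x = 0.
    move=> Omx; apply/eqP; apply: contraT => fx.
    have : A (fun y => (D + 1) / f x * f y).
      split; first exact: span_funZ.
      have := LqZ ((D + 1) / f x); rewrite L1 powR0 ?gt_eqF// mulr0.
      by move/powR_eq0_eq0 => ->.
    by move=> /AD/(_ Omx); rewrite divfK// ger0_norm ?addr_ge0 ?(ltW D0)//; lra.
  rewrite L1 powR0 ?gt_eqF// big1 ?mulr0//.
  by move=> j _; rewrite fx0// normr0 powR0// gt_eqF.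
(* Both sides are homogeneous of degree [q], so [f] is normalised to mean 1; a deviation of at most
   1/2 then gives the factors 1/2 and 3/2. *)
have {}L0 : 0 < L by rewrite lt0r L1.
have Lq0 : 0 < L `^ q by exact: powR_gt0.
have Li : `|L^-1| `^ q = (L `^ q)^-1.
  by rewrite gtr0_norm ?invr_gt0// -powR_inv1 ?ltW// -powRrM mulN1r powRN.
have Lg : Lq_norm mu Om q (fun x => L^-1 * f x) `^ q = 1.
  by rewrite LqZ Li mulVf ?gt_eqF.
have Ag : A (fun x => L^-1 * f x).
  split; first exact: span_funZ.
  by move: (powR_eq1_eq1 q0 (powR_ge0 _ _) Lg); rewrite -/(Lq_norm mu Om q (fun x => L^-1 * f x)) => ->.
have mg : @mean R _ (Borel_Rd R d) mu Om (fun x => `|L^-1 * f x| `^ q) = 1.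
  exact: etrans (esym (@Lq_norm_powR R d mu Om q q0 _)) Lg.
have := xiP _ Ag; rewrite mg.
under eq_bigr do rewrite normrM powRM// Li.
rewrite -mulr_sumr mulrCA; set S := m%:R^-1 * _ => /(half_scale_le Lq0).
by rewrite mulVKf ?gt_eqF.
Qed.
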